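(* For every $\varepsilon>0$ and all functions $g,h:\mathbb N\to\mathbb N$ there is a positive integer $N\leq\Phi(\varepsilon,g,h)$ such that $$\|S_mT^mx-S_nT^kx\|<\varepsilon\quad\text{for all } m,n\in[N,N+g(N)]\text{ and all } k\leq h(N).$$
   Context: Conventions: $\mathbb N=\{0,1,2,\dots\}$; for $m,n\in\mathbb N$, $[m,n]$ denotes the set of natural numbers $k$ with $m\le k\le n$; sums and maxima of functions are pointwise; $\operatorname{Id}(n)=n$; for $g:\mathbb N\to\mathbb N$ put $g^M(n):=\max_{m\le n}g(m)$. Setting: $X$ is a uniformly convex real Banach space, $C\subseteq X$ is non-empty, closed and convex, $b>0$ satisfies $\|y\|\le b/2$ for all $y\in C$, and $T:C\to C$ is nonexpansive ($\|Ty-Tz\|\le\|y-z\|$ for all $y,z\in C$) and has a fixed point. For $n\ge1$ and $y\in C$, $S_ny:=\frac1n\sum_{i=0}^{n-1}T^iy$; thus $S_nT^kx=\frac1n\sum_{i=0}^{n-1}T^{k+i}x$. Modulus of convexity: $\eta:[0,\infty)\to[0,\infty)$ is a given continuous function such that $\|\frac{u+v}2\|\le1-\eta(\varepsilon)$ whenever $\varepsilon>0$, $u,v\in X$, $\|u\|,\|v\|\le1$, $\|u-v\|\ge\varepsilon$, and such that $0<s<t$ implies $0=\eta(0)<\eta(s)<\eta(t)$ and $\eta(s)/s\le\eta(t)/t$. Constants $c,q$: $X^2$ carries the norm $\|(u,v)\|_2=(\|u\|^2+\|v\|^2)^{1/2}$, and $c>0$, $q>1$ are given such that $\mathbb E(\|\sum_{i=1}^nZ_i\|_2^q)\le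 c^q\sum_{i=1}^n\mathbb E(\|Z_i\|_2^q)$ for all $n$ and all independent (Bochner integrable) mean-zero random variables $Z_1,\dots,Z_n$ with values in $X^2$. Function $\gamma$: for $t\ge0$ let $\gamma_2(t)=\min\{t,\frac b2\eta(\frac{4t}b)\}$ and $\gamma_{n+1}(t)=\min\{\gamma_n(t),\gamma_2(\gamma_n(t/2)/3)\}$ for $n\ge2$. Let $\gamma(0)=0$ and, for $t>0$, $\gamma(t)=\gamma_{p(t)}(t/3)$ with $p(t)=\max\{2,\lceil(\frac{6bc}{\sqrt2\,t})^{q/(q-1)}\rceil\}$. Rate $A$: a point $x\in C$ is fixed, $\alpha^i_n:=\|T^nx-T^{n+i}x\|$, and a map $(\varepsilon,g,h)\mapsto A(\varepsilon,g,h)\in\mathbb N$ is given such that for all $\varepsilon>0$ and $g,h:\mathbb N\to\mathbb N$ there is $N\le A(\varepsilon,g,h)$ with $|\alpha^i_m-\alpha^i_n|<\varepsilon$ for all $m,n\in[N,N+g(N)]$ and $i\le h(N)$. Derived maps, for $\varepsilon>0$ and $g,h:\mathbb N\to\mathbb N$: (1) $B(\varepsilon,g,h):=A(\gamma(\varepsilon),\hat g,\hat h)$ with $\hat g(N)=N+2g(N)+h(N)$ and $\hat h(N)=2(N+g(N))$. (2) $g_\varepsilon(n):=n'+g^M(n')$ with $n'=\max\{n,\lceil 4nb/\varepsilon\rceil\}$; $g_\varepsilon^{(0)}(n)=\max\{1,n\}$ and $g_\varepsilon^{(i+1)}(n)=g_\varepsilon(g_\varepsilon^{(i)}(n))$;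 and, with $K=\lceil 2b/\varepsilon\rceil$, $$\Theta^B(\varepsilon,g,h):=g_\varepsilon^{(K+1)}\left(B\left(\tfrac\varepsilon4,\,g_\varepsilon^{(K+2)},\,\max\{2\cdot g_\varepsilon^{(K+1)},\,h^M\circ g_\varepsilon^{(K+1)}\}\right)\right).$$ (3) $\delta(\varepsilon):=\min\{b,\frac\varepsilon4,\frac\varepsilon8\,\eta(\frac\varepsilon{2b})\}$, $g'_\varepsilon(n):=\lceil\frac{6b(n+g(n))}{\delta(\varepsilon)}\rceil$, and $\Delta^B(\varepsilon,g,h):=\Theta^B(\delta(\varepsilon),\,g+g'_\varepsilon,\,\max\{\operatorname{Id}+g+2g'_\varepsilon,\,h\})$. (4) $\Psi(\varepsilon,g,h):=\Delta^B(\frac\varepsilon4,g''_{\varepsilon,h},h)$ with $g''_{\varepsilon,h}(N):=\max\{g(N),\lceil\frac{4b\,h(N)}\varepsilon\rceil\}$. (5) $N_\varepsilon(n):=\max\{n,\lceil\frac{6nb}\varepsilon\rceil\}$ and $\Phi(\varepsilon,g,h):=N_\varepsilon(\Psi(\frac\varepsilon2,g',h'))$ with $g'(n):=N_\varepsilon(n)+g(N_\varepsilon(n))$ and $h'(n):=g'(n)+h(N_\varepsilon(n))$. *)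

(* Defs.v *)
From HB Require Import structures.
From mathcomp Require Import all_boot all_order all_algebra.
From mathcomp Require Import all_classical all_reals all_analysis.
Set Implicit Arguments.
Unset Strict Implicit.
Unset Printing Implicit Defensive.
Import Order.TTheory GRing.Theory Num.Theory.
Import numFieldNormedType.Exports.
Local Open Scope classical_set_scope.
Local Open Scope ring_scope.

Definition uniformly_convex (R : realType) (X : normedModType R) : Prop :=
  forall eps : R, 0 < eps -> exists2 delta : R, 0 < delta &
    forall u v : X, `|u| <= 1 -> `|v| <= 1 -> eps <= `|u - v| ->
      `|2^-1 *: (u + v)| <= 1 - delta.

(* [eta] is only meaningful on [0, +oo[ ; its values on negative reals are
   irrelevant. *)
Definition convexity_modulus (R : realType) (X : normedModType R)
    (eta : R -> R) : Prop :=
  [/\ {within `[0, +oo[, continuous eta},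
      forall t : R, 0 <= t -> 0 <= eta t,
      forall (eps : R) (u v : X), 0 < eps -> `|u| <= 1 -> `|v| <= 1 ->
        eps <= `|u - v| -> `|2^-1 *: (u + v)| <= 1 - eta eps &
      forall s t : R, 0 < s -> s < t ->
        [/\ eta 0 = 0, 0 < eta s, eta s < eta t & eta s / s <= eta t / t]].

Definition nonexpansive_on (R : realType) (X : normedModType R)
    (C : set X) (T : X -> X) : Prop :=
  forall y z, C y -> C z -> `|T y - T z| <= `|y - z|.

Definition ergodic_mean (R : realType) (X : normedModType R) (T : X -> X)
    (n : nat) (y : X) : X :=
  n%:R^-1 *: \sum_(i < n) iter i T y.

Definition norm2 (R : realType) (X : normedModType R) (w : X * X) : R :=
  Num.sqrt (`|w.1| ^+ 2 + `|w.2| ^+ 2).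

Section BochnerX2.
Context (R : realType) (X : normedModType R).
Context d (Omega : measurableType d) (P : probability Omega R).
Implicit Types Z s : Omega -> X * X.

Definition simple_rv s : Prop :=
  finite_set (range s) /\ forall v, measurable (s @^-1` [set v]).

Definition simple_mean s : X * X :=
  \sum_(v \in range s) fine (P (s @^-1` [set v])) *: v.

(* The topology that the library puts on [X * X] is the product topology, which
   is the one induced by [norm2]. *)
Definition strongly_measurable Z : Prop :=
  exists2 s : (Omega -> X * X)^nat,
    forall n, simple_rv (s n) & forall w, s n w @[n --> \oo] --> Z w.

Definition bochner_mean Z (m : X * X) : Prop :=
  strongly_measurable Z /\
  exists s : (Omega -> X * X)^nat,
    [/\ forall n, simple_rv (s n),
        (\int[P]_w (norm2 (Z w - s n w))%:E)%E @[n --> \oo] --> 0%E &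
        simple_mean (s n) @[n --> \oo] --> m].

(* Taking some of the Borel sets [U i] to be [setT] gives the product rule for
   every subfamily. *)
Definition independent_rvs n (Z : 'I_n -> Omega -> X * X) : Prop :=
  forall U : 'I_n -> set (X * X),
    (forall i, <<s [set V : set (X * X) | open V] >> (U i)) ->
    P (\bigcap_i (Z i @^-1` U i)) = (\prod_(i < n) P (Z i @^-1` U i))%E.

End BochnerX2.

(* Expectations are extended-real, so infinite [q]-th moments are allowed. *)
Definition type_inequality (R : realType) (X : normedModType R) (c q : R)
    : Prop :=
  forall d (Omega : measurableType d) (P : probability Omega R)
    (n : nat) (Z : 'I_n -> Omega -> X * X),
    (forall i, bochner_mean P (Z i) 0) -> independent_rvs P Z ->
    ('E_P[fun w => (norm2 (\sum_(i < n) Z i w) `^ q)%R]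
       <= (c `^ q)%:E * \sum_(i < n) 'E_P[fun w => (norm2 (Z i w) `^ q)%R])%E.

(* Natural-valued ceiling; all its arguments below are nonnegative. *)
Definition nceil (R : realType) (t : R) : nat := `|Num.ceil t|%N.

Definition maxfun (g : nat -> nat) (n : nat) : nat := \max_(m < n.+1) g m.

Section Gamma.
Context (R : realType) (b c q : R) (eta : R -> R).

Definition gamma2 (t : R) : R := Num.min t (b / 2 * eta (4 * t / b)).

(* [gamma_from2 k] is the function written gamma_{k+2}. *)
Fixpoint gamma_from2 (k : nat) (t : R) : R :=
  if k is j.+1 then
    Num.min (gamma_from2 j t) (gamma2 (gamma_from2 j (t / 2) / 3))
  else gamma2 t.

Definition gamma_index (t : R) : nat :=
  maxn 2 (nceil ((6 * b * c / (Num.sqrt 2 * t)) `^ (q / (q - 1)))).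

Definition gamma (t : R) : R :=
  if t == 0 then 0 else gamma_from2 (gamma_index t - 2)%N (t / 3).

End Gamma.

Definition rate (R : realType) := R -> (nat -> nat) -> (nat -> nat) -> nat.

Definition alpha (R : realType) (X : normedModType R) (T : X -> X) (x : X)
    (i n : nat) : R := `|iter n T x - iter (n + i) T x|.

Definition is_alpha_rate (R : realType) (X : normedModType R) (T : X -> X)
    (x : X) (A : rate R) : Prop :=
  forall (eps : R) (g h : nat -> nat), 0 < eps ->
    exists2 N : nat, (N <= A eps g h)%N &
      forall m n i : nat,
        (N <= m <= N + g N)%N -> (N <= n <= N + g N)%N -> (i <= h N)%N ->
        `|alpha T x i m - alpha T x i n| < eps.

Definition rateB (R : realType) (b c q : R) (eta : R -> R) (A : rate R)
    : rate R :=
  fun eps g h => A (gamma b c q eta eps)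
    (fun N => N + 2 * g N + h N)%N (fun N => 2 * (N + g N))%N.

Definition gstep (R : realType) (b eps : R) (g : nat -> nat) (n : nat) : nat :=
  let n' := maxn n (nceil (4 * n%:R * b / eps)) in (n' + maxfun g n')%N.

Definition giter (R : realType) (b eps : R) (g : nat -> nat) (i n : nat)
    : nat := iter i (gstep b eps g) (maxn 1 n).

Definition rateTheta (R : realType) (b : R) (B : rate R) : rate R :=
  fun eps g h =>
    let K := nceil (2 * b / eps) in
    giter b eps g (K + 1)%N
      (B (eps / 4) (giter b eps g (K + 2)%N)
         (fun n => maxn (2 * giter b eps g (K + 1)%N n)%N
                        (maxfun h (giter b eps g (K + 1)%N n)))).

Definition delta (R : realType) (b : R) (eta : R -> R) (eps : R) : R :=
  Num.min b (Num.min (eps / 4) (eps / 8 * eta (eps / (2 * b)))).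

Definition rateDelta (R : realType) (b : R) (eta : R -> R) (B : rate R)
    : rate R :=
  fun eps g h =>
    let g' n := nceil (6 * b * (n + g n)%N%:R / delta b eta eps) in
    rateTheta b B (delta b eta eps)
      (fun n => g n + g' n)%N
      (fun n => maxn (n + g n + 2 * g' n)%N (h n)).

Definition ratePsi (R : realType) (b : R) (eta : R -> R) (B : rate R)
    : rate R :=
  fun eps g h =>
    rateDelta b eta B (eps / 4)
      (fun N => maxn (g N) (nceil (4 * b * (h N)%:R / eps))) h.

Definition Neps (R : realType) (b eps : R) (n : nat) : nat :=
  maxn n (nceil (6 * n%:R * b / eps)).

Definition ratePhi (R : realType) (b : R) (eta : R -> R) (B : rate R)
    : rate R :=
  fun eps g h =>
    let g' n := (Neps b eps n + g (Neps b eps n))%N in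
    let h' n := (g' n + h (Neps b eps n))%N in
    Neps b eps (ratePsi b eta B (eps / 2) g' h').

(* Main.v *)
(* The gap [|y_i - y_j| - |S y_i - S y_j|] controls how far a nonexpansive map
   [S] is from commuting with convex combinations of the [y_i]: for two points
   this is uniform convexity, for [n] points induction, and for arbitrarily many
   points Maurey's empirical method in [X * X], which replaces the combination
   by an average of a bounded number [p] of the points [(y_i, S y_i)].

   Along the orbit of [x] this gap is [alpha i n - alpha i (n + k)], so the rate
   for the convergence of [alpha i] makes [T ^ k] almost commute with the Cesaro
   means [u_n = S_n T^n x] and with the midpoints of [u_m] and [u_n].

   Fix a fixed point [p]. If [m] is much larger than [n], then [u_m] is close to
   the average of the [T ^ k u_n], so [|u_n - p|] is almost nonincreasing and
   hence metastable. If [u_m] and [u_n] were far apart, their midpoint would be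
   markedly closer to [p]; for large [L] the mean [u_L] is close to an average
   of iterates of that midpoint, contradicting the stability of [|u_n - p|].
   Finally [S_n T^k x] is close to an average of means [S_N T^(N + j) x] with
   [N] much smaller than [n], which gives uniformity in [k]. *)
Require Import Defs.
From HB Require Import structures.
From mathcomp Require Import all_boot all_order all_algebra.
From mathcomp Require Import all_classical all_reals all_analysis.
From mathcomp Require Import ring lra zify.
Import Order.TTheory GRing.Theory Num.Theory.
Import numFieldNormedType.Exports.
Local Open Scope classical_set_scope.
Local Open Scope ring_scope.
Set Implicit Arguments.
Unset Strict Implicit.
Unset Printing Implicit Defensive.

(** * Discrete probabilities and Maurey's empirical method *)

Section FiniteProbability.
Context (R : realType) (I : finType) (w : I -> R).
Hypothesis w_ge0 : forall i, 0 <= w i.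
Hypothesis w_sum1 : \sum_i w i = 1.

Lemma exists_outcome : exists i, w i != 0.
Proof.
apply/existsP; apply: contraT => /existsPn w0.
have := w_sum1; rewrite big1 => [/eqP|i _]; first by rewrite eq_sym oner_eq0.
by apply/eqP; rewrite -[_ == _]negbK w0.
Qed.

(* The elements of [I] are coded by naturals, as [nat] carries the discrete
   sigma-algebra; codes [k >= #|I|] get a default value and probability [0]. *)
Definition nth_outcome (k : nat) : I :=
  nth (xchoose exists_outcome) (enum I) k.

Definition atom (k : nat) : {measure set nat -> \bar R} :=
  mscale (NngNum (w_ge0 (nth_outcome k))) \d_k.

Definition finprob : set nat -> \bar R := msum atom #|I|.

HB.instance Definition _ := Measure.on finprob.

Lemma nth_outcome_rank i : nth_outcome (enum_rank i) = i.
Proof. by rewrite /nth_outcome nth_enum_rank. Qed.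

Lemma sum_nth_outcome (F : nat -> \bar R) :
  (\sum_(k < #|I|) F k = \sum_i F (@enum_rank I i))%E.
Proof.
rewrite [RHS](reindex (@enum_val I predT)) /=; last first.
  exact/onW_bij/enum_val_bij.
by apply: eq_bigr => k _; rewrite enum_valK.
Qed.

Lemma finprob_preimage (B : set I) :
  finprob (nth_outcome @^-1` B) = (\sum_i w i * \1_B i)%:E.
Proof.
rewrite /finprob /msum (sum_nth_outcome (fun k => atom k _)) -sumEFin.
apply: eq_bigr => i _; rewrite /atom /= /mscale /= diracE nth_outcome_rank.
rewrite EFinM indicE; congr (_ * (_%:R)%:E)%E; congr (nat_of_bool _).
by apply/idP/idP; rewrite !inE /= nth_outcome_rank.
Qed.

Lemma finprob_setT : finprob setT = 1%E.
Proof.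
rewrite -[setT](preimage_setT nth_outcome) finprob_preimage.
by under eq_bigr do rewrite indicT mulr1; rewrite w_sum1.
Qed.

HB.instance Definition _ :=
  Measure_isProbability.Build _ _ _ finprob finprob_setT.

Lemma finprob_integral (f : I -> R) : (forall i, 0 <= f i) ->
  (\int[finprob]_k (f (nth_outcome k))%:E = (\sum_i w i * f i)%:E)%E.
Proof.
move=> f_ge0; rewrite ge0_integral_measure_sum //; last first.
  by move=> k _; rewrite lee_fin.
rewrite (sum_nth_outcome (fun k => \int[atom k]_x (f (nth_outcome x))%:E))%E.
rewrite -sumEFin; apply: eq_bigr => i _.
rewrite ge0_integral_mscale //; last by move=> k _; rewrite lee_fin.
by rewrite integral_dirac // diracT mul1e /= nth_outcome_rank.
Qed.

End FiniteProbability.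

Section FiniteProbabilityMean.
Context (R : realType) (X : normedModType R) (I : finType) (w : I -> R).
Hypothesis w_ge0 : forall i, 0 <= w i.
Hypothesis w_sum1 : \sum_i w i = 1.
Let P : probability nat R := finprob w_ge0 w_sum1.

Lemma finprob_simple_mean (F : I -> X * X) :
  simple_mean P (F \o nth_outcome w_sum1) = \sum_i w i *: F i.
Proof.
rewrite /simple_mean (@fsbig_fwiden _ _ _ _ (undup (codom F))) /=; last first.
- by move=> u [/=]; rewrite mem_undup => /codomP[i ->] [];
    exists (enum_rank i) => //=; rewrite nth_outcome_rank.
- exact: undup_uniq.
- by move=> _ [k _ <-] /=; rewrite mem_undup codom_f.
under eq_bigr => u _.
  rewrite (_ : (F \o _) @^-1` _ =
    nth_outcome w_sum1 @^-1` (F @^-1` [set u])) //.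
  rewrite finprob_preimage /= scaler_suml; over.
rewrite exchange_big /=; apply: eq_bigr => i _.
rewrite (bigD1_seq (F i)) ?mem_undup ?codom_f ?undup_uniq //=.
rewrite big1 => [|u uFi]; rewrite indicE.
  by rewrite mem_set //= mulr1 addr0.
rewrite memNset ?mulr0 ?scale0r //= => Fiu.
by rewrite Fiu eqxx in uFi.
Qed.

(** A function of the coded outcome is itself simple, so a constant sequence witnesses both strong
    measurability and the mean. *)
Lemma finprob_bochner_mean (F : I -> X * X) :
  \sum_i w i *: F i = 0 -> bochner_mean P (F \o nth_outcome w_sum1) 0.
Proof.
move=> F0; have simple : simple_rv (F \o nth_outcome w_sum1).
  split=> //; apply: (@sub_finite_set _ _ (F @` setT)).
    by move=> _ [k _ <-]; exists (nth_outcome w_sum1 k).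
  exact/finite_image/finite_finset.
split; first by exists (fun=> F \o nth_outcome w_sum1) => // k; exact: cvg_cst.
exists (fun=> F \o nth_outcome w_sum1); split=> //.
  under eq_fun do under eq_integral do
    rewrite subrr /norm2 normr0 expr0n addr0 sqrtr0.
  by rewrite integral0; exact: cvg_cst.
by rewrite finprob_simple_mean F0; exact: cvg_cst.
Qed.

End FiniteProbabilityMean.

(** * Independent samples from a finite distribution *)

Section ProductWeights.
Context (R : realType) (I : finType) (w : I -> R) (p : nat).
Hypothesis w_ge0 : forall i, 0 <= w i.
Hypothesis w_sum1 : \sum_i w i = 1.

Definition prod_weight (f : {ffun 'I_p -> I}) : R := \prod_j w (f j).

Lemma prod_weight_ge0 f : 0 <= prod_weight f.
Proof. exact: prodr_ge0. Qed.

(** Independence of the coordinates of [f], in the form of distributivity of a product over sums. *)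
Lemma sum_prod_weight (G : 'I_p -> I -> R) :
  \sum_f prod_weight f * \prod_j G j (f j) = \prod_j \sum_i w i * G j i.
Proof.
by rewrite bigA_distr_bigA; apply: eq_bigr => f _; rewrite -big_split.
Qed.

Lemma prod_weight_sum1 : \sum_f prod_weight f = 1.
Proof.
under eq_bigr do rewrite -[prod_weight _]mulr1 -[1](@big1 _ 1 *%R 'I_p
  (index_enum _) xpredT (fun=> 1)) //.
rewrite (sum_prod_weight (fun _ _ => 1)) big1 // => j _.
by under eq_bigr do rewrite mulr1.
Qed.

Lemma sum_prod_weight_marginal (j : 'I_p) (G : I -> R) :
  \sum_f prod_weight f * G (f j) = \sum_i w i * G i.
Proof.
pose G' l i := if l == j then G i else 1.
transitivity (\sum_f prod_weight f * \prod_l G' l (f l)).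
  apply: eq_bigr => f _; rewrite (bigD1 j) //= /G' eqxx big1 ?mulr1 //.
  by move=> l /negbTE ->.
rewrite sum_prod_weight (bigD1 j) //= /G' eqxx [X in _ * X]big1 ?mulr1 //.
move=> l /negbTE ->.
by under eq_bigr do rewrite mulr1.
Qed.

(** The product formula is scalar, so [v (f j)] is expanded along the indicators of [f j == i],
    whose expectations are the [w i]. *)
Lemma sum_prod_weight_marginalZ (V : lmodType R) (j : 'I_p) (v : I -> V) :
  \sum_f prod_weight f *: v (f j) = \sum_i w i *: v i.
Proof.
have expand (f : {ffun 'I_p -> I}) :
    v (f j) = \sum_i ((f j == i)%:R : R) *: v i.
  rewrite (bigD1 (f j)) //= eqxx scale1r big1 ?addr0 // => i.
  by rewrite eq_sym => /negbTE ->; rewrite scale0r.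
under eq_bigr do rewrite expand scaler_sumr.
rewrite exchange_big /=; apply: eq_bigr => i _.
under eq_bigr do rewrite scalerA.
rewrite -scaler_suml (sum_prod_weight_marginal j (fun l => (l == i)%:R)).
rewrite (bigD1 i) //= eqxx mulr1 big1 ?addr0 // => l /negbTE ->.
by rewrite mulr0.
Qed.

End ProductWeights.

Section Maurey.
Context (R : realType) (X : normedModType R) (c q : R).
Hypothesis q_gt1 : 1 < q.
Hypothesis cq_type : type_inequality X c q.
Context (I : finType) (w : I -> R).
Hypothesis w_ge0 : forall i, 0 <= w i.
Hypothesis w_sum1 : \sum_i w i = 1.

(* Maurey's empirical method: the type inequality for [p] independent copies of
   the random variable taking the value [v i] with probability [w i]. *)
Lemma maurey_selection (v : I -> X * X) (D : R) (p : nat) :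
    \sum_i w i *: v i = 0 -> (forall i, norm2 (v i) <= D) ->
  exists f : 'I_p -> I,
    norm2 (\sum_j v (f j)) `^ q <= c `^ q * (p%:R * D `^ q).
Proof.
move=> v0 vD; apply/not_existsP => bad_selection.
pose W := prod_weight w (p := p).
have W_ge0 := @prod_weight_ge0 R I w p w_ge0 : forall f, 0 <= W f.
have W_sum1 := prod_weight_sum1 p w_sum1 : \sum_f W f = 1.
pose P : probability nat R := finprob W_ge0 W_sum1.
pose Z (j : 'I_p) :=
  (fun f : {ffun 'I_p -> I} => v (f j)) \o nth_outcome W_sum1.
have Zmean j : bochner_mean P (Z j) 0.
  by apply: finprob_bochner_mean; rewrite sum_prod_weight_marginalZ.
(* The indicator of the joint event is a product over the coordinates, so [sum_prod_weight] factors
   its probability. *)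
have Zindep : independent_rvs P Z.
  move=> U _; rewrite (_ : \bigcap_i _ = nth_outcome W_sum1 @^-1`
      [set f | forall j, U j (v (f j))]); last first.
    by apply/seteqP; split=> k /= Uk j => [|_]; exact: Uk.
  transitivity ((\prod_j \sum_i w i * \1_(U j) (v i))%:E).
    rewrite [LHS]finprob_preimage -sum_prod_weight; congr (_%:E).
    apply: eq_bigr => f _; congr (_ * _); rewrite indicE.
    have [Uf|nUf] := pselect (forall j, U j (v (f j))).
      by rewrite mem_set // big1 // => j _; rewrite indicE mem_set.
    rewrite memNset //; have /existsNP[j nUj] := nUf.
    by rewrite (bigD1 j) //= indicE memNset ?mul0r.
  rewrite -prodEFin; apply: eq_bigr => j _.
  rewrite (_ : Z j @^-1` U j = nth_outcome W_sum1 @^-1`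
    [set f | U j (v (f j))]) // [RHS]finprob_preimage; congr (_%:E).
  rewrite -(sum_prod_weight_marginal w_sum1 j (fun i => \1_(U j) (v i))).
  by apply: eq_bigr.
have := cq_type Zmean Zindep; apply/negP; rewrite -ltNge.
have expectE (F : {ffun 'I_p -> I} -> R) : (forall f, 0 <= F f) ->
    ('E_P[F \o nth_outcome W_sum1] = (\sum_f W f * F f)%:E)%E.
  by move=> F0; rewrite unlock -finprob_integral.
rewrite [ltRHS](_ : _ = 'E_P[(fun f : {ffun 'I_p -> I} =>
  (norm2 (\sum_j v (f j)) `^ q)%R) \o nth_outcome W_sum1])%E //.
rewrite expectE => [|f]; last exact: powR_ge0.
have EZ j : ('E_P[fun k => (norm2 (Z j k) `^ q)%R] <= (D `^ q)%:E)%E.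
  rewrite [leLHS](_ : _ = 'E_P[(fun f : {ffun 'I_p -> I} =>
    (norm2 (v (f j)) `^ q)%R) \o nth_outcome W_sum1])%E //.
  rewrite expectE => [|f]; last exact: powR_ge0.
  rewrite lee_fin (le_trans (y := \sum_f W f * D `^ q)) //; last first.
    by rewrite -mulr_suml W_sum1 mul1r.
  apply: ler_sum => f _; rewrite ler_wpM2l // ge0_ler_powR ?nnegrE //.
  - by rewrite (le_trans _ (ltW q_gt1)).
  - exact: sqrtr_ge0.
  - exact: le_trans (sqrtr_ge0 _) (vD (f j)).
apply: (@le_lt_trans _ _ (c `^ q * (p%:R * D `^ q))%:E).
  rewrite EFinM lee_wpmul2l ?lee_fin ?powR_ge0 //.
  apply: (@le_trans _ _ (\sum_(j < p) (D `^ q)%:E)%E).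
    by apply: lee_sum => j _; exact: EZ.
  by rewrite sumEFin sumr_const card_ord mulr_natl.
rewrite lte_fin -[ltLHS]mul1r -[X in X * _]W_sum1 mulr_suml.
have bad (f : 'I_p -> I) :
    c `^ q * (p%:R * D `^ q) < norm2 (\sum_j v (f j)) `^ q.
  by rewrite ltNge; apply/negP; exact: bad_selection.
(* An outcome of nonzero weight makes the comparison of expectations strict. *)
have [f0 Wf0] := exists_outcome W_sum1.
rewrite (bigD1 f0) //= [ltRHS](bigD1 f0) //=; apply: ltr_leD.
  by rewrite ltr_pM2l // lt_neqAle eq_sym Wf0 W_ge0.
by apply: ler_sum => f _; rewrite ler_wpM2l // ltW.
Qed.

End Maurey.

(** * Uniform convexity and Bruck's inequality *)

Section Convexity.
Context (R : realType) (X : normedModType R) (C : set X).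
Hypothesis C_convex : convex_set C.

Lemma convex_set_comb (u v : X) (l : R) :
  C u -> C v -> 0 <= l <= 1 -> C (l *: u + (1 - l) *: v).
Proof.
move=> Cu Cv l01.
have l_itv : Itv.spec (@Itv.num_sem R) (Itv.Real `[0%Z, 1%Z]) l.
  by rewrite /= /Itv.num_sem /= in_itv /= num_real.
have := @C_convex u v (Itv.mk l_itv) (mem_set Cu) (mem_set Cv).
by rewrite inE.
Qed.

Lemma convex_set_sum (I : finType) (w : I -> R) (y : I -> X) :
    (forall i, 0 <= w i) -> \sum_i w i = 1 -> (forall i, C (y i)) ->
  C (\sum_i w i *: y i).
Proof.
move=> w_ge0 w_sum1 Cy; have [i0 _] := exists_outcome w_sum1.
(* Partial sums have weight below 1, so the induction carries a point of [C] scaled by the partial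
   weight; while that weight is 0, any point of [C] serves. *)
suff [z Cz ->] : exists2 z, C z & \sum_i w i *: y i = (\sum_i w i) *: z.
  by rewrite w_sum1 scale1r.
elim: (index_enum I) => [|i s [z Cz IH]].
  by exists (y i0) => //; rewrite !big_nil scale0r.
rewrite !big_cons IH; set W := \sum_(_ <- _) _.
have W_ge0 : 0 <= W by exact: sumr_ge0.
have [W0|wW_neq0] := eqVneq (w i + W) 0.
  have [-> ->] : w i = 0 /\ W = 0 by have := w_ge0 i; split; lra.
  by exists z; rewrite // addr0 !scale0r addr0.
exists ((w i / (w i + W)) *: y i + (1 - w i / (w i + W)) *: z).
  apply: convex_set_comb => //; have wi := w_ge0 i.
  by rewrite divr_ge0 ?addr_ge0 // ler_pdivrMr ?mul1r; lra.
by rewrite scalerDr !scalerA; congr (_ *: _ + _ *: _); field.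
Qed.

End Convexity.

(** * Consequences of a modulus of convexity *)

Section ConvexityModulus.
Context (R : realType) (X : normedModType R) (eta : R -> R).
Hypothesis eta_mod : convexity_modulus X eta.

Lemma eta0 : eta 0 = 0.
Proof. by case: eta_mod => _ _ _ /(_ 1 2 ltr01); case=> //; lra. Qed.

Lemma eta_gt0 s : 0 < s -> 0 < eta s.
Proof. by case: eta_mod => _ _ _ /(_ s (s + 1)) H s0; case: H => //; lra. Qed.

Lemma eta_le s t : 0 <= s -> s <= t -> eta s <= eta t.
Proof.
move=> s_ge0; rewrite le_eqVlt => /orP[/eqP->//|st]; apply/ltW.
move: s_ge0 st; rewrite le_eqVlt => /orP[/eqP<-|s0 st].
  by rewrite eta0; exact: eta_gt0.
by case: eta_mod => _ _ _ /(_ _ _ s0 st)[].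
Qed.

Lemma eta_slope s t : 0 < s -> s <= t -> eta s / s <= eta t / t.
Proof.
move=> s0; rewrite le_eqVlt => /orP[/eqP->//|st].
by case: eta_mod => _ _ _ /(_ _ _ s0 st)[].
Qed.

(** Monotonicity of the slope [eta s / s], read at the points [t / s <= t / r]. *)
Lemma eta_scale (t r s : R) : 0 <= t -> 0 < r -> r <= s ->
  s * eta (t / s) <= r * eta (t / r).
Proof.
move=> t_ge0 r0 rs; have s0 : 0 < s by exact: lt_le_trans rs.
move: t_ge0; rewrite le_eqVlt => /orP[/eqP<-|t0].
  by rewrite !mul0r eta0 !mulr0.
have := @eta_slope (t / s) (t / r); rewrite divr_gt0 // => /(_ isT).
rewrite ler_pM2l // lef_pV2 // => /(_ rs); rewrite !invfM !invrK.
have e (x y : R) : x * (t^-1 * y) = t^-1 * (y * x) by ring.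
by rewrite !e ler_pM2l ?invr_gt0.
Qed.

Lemma norm_mid_le1 (u v : X) : `|u| <= 1 -> `|v| <= 1 ->
  `|2^-1 *: (u + v)| <= 1 - eta `|u - v|.
Proof.
move=> u1 v1; have [uv|uv] := eqVneq (u - v) 0; last first.
  by case: eta_mod => _ _ H _; apply: H; rewrite ?normr_gt0.
rewrite uv normr0 eta0 subr0 normrZ ger0_norm ?invr_ge0 //.
by have := ler_normD u v; lra.
Qed.

(** By symmetry [l <= 1/2]; the combination then puts weight [2 * l] on the midpoint and the rest on
    [v], so it inherits the fraction [2 * l] of the midpoint's gain. *)
Lemma norm_comb_le (u v : X) (l : R) : `|u| <= 1 -> `|v| <= 1 -> 0 <= l <= 1 ->
  `|l *: u + (1 - l) *: v| <= 1 - 2 * (l * (1 - l)) * eta `|u - v|.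
Proof.
move=> u1 v1; wlog l_half : u v l u1 v1 / l <= 2^-1 => [wlog_hyp|].
  move=> l01; have [/wlog_hyp->//|l_half] := lerP l 2^-1.
  have := wlog_hyp v u (1 - l) v1 u1; have -> : 1 - (1 - l) = l by ring.
  by rewrite [_ *: v + _]addrC [`|v - u|]distrC [(1 - l) * _]mulrC; apply; lra.
move=> /andP[l0 l1].
have mid := norm_mid_le1 u1 v1.
have -> : l *: u + (1 - l) *: v =
    (2 * l) *: (2^-1 *: (u + v)) + (1 - 2 * l) *: v.
  rewrite scalerA mulrAC divff // mul1r scalerDr -addrA -scalerDl.
  by congr (_ + _ *: _); ring.
move: (2^-1 *: (u + v)) mid => m mid.
apply: le_trans (ler_normD _ _) _; rewrite !normrZ !ger0_norm; [|lra..].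
have eta_ge0 : 0 <= eta `|u - v|.
  by rewrite -eta0; apply: eta_le.
have : 2 * l * `|m| <= 2 * l * (1 - eta `|u - v|).
  by rewrite ler_wpM2l; lra.
have : (1 - 2 * l) * `|v| <= (1 - 2 * l) * 1 by rewrite ler_wpM2l; lra.
have : 0 <= l * l * eta `|u - v| by rewrite !mulr_ge0.
nra.
Qed.

Lemma norm_mid_le (u v : X) (a : R) : 0 < a -> `|u| <= a -> `|v| <= a ->
  `|2^-1 *: (u + v)| <= a - a * eta (`|u - v| / a).
Proof.
move=> a0 ua va.
have scaled (z : X) : `|z| <= a -> `|a^-1 *: z| <= 1.
  by rewrite normrZ gtr0_norm ?invr_gt0 // ler_pdivrMl ?mulr1.
have := norm_mid_le1 (scaled _ ua) (scaled _ va).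
rewrite -scalerDr -scalerBr scalerA [2^-1 * _]mulrC -scalerA !normrZ.
rewrite !gtr0_norm ?invr_gt0 // ler_pdivrMl // => /le_trans; apply.
by rewrite mulrBr mulr1 lerD2l lerN2 [a^-1 * _]mulrC.
Qed.

End ConvexityModulus.

Lemma nceil_ge (R : realType) (t : R) : t <= (nceil t)%:R.
Proof. by rewrite natr_absz (le_trans (ceil_ge t)) // ler_int ler_norm. Qed.

Lemma mean_sub (R : realType) (V : lmodType R) (l : nat) (u : 'I_l -> V)
    (z : V) : (0 < l)%N ->
  l%:R^-1 *: (\sum_j u j) - z = l%:R^-1 *: \sum_j (u j - z).
Proof.
move=> l_gt0; rewrite sumrB sumr_const card_ord scalerBr -[z *+ l]scaler_nat.
by rewrite scalerA mulVf ?scale1r // pnatr_eq0 -lt0n.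
Qed.

Lemma sub_decomp (V : zmodType) (u v u' v' : V) :
  u - v = (u' - v') + ((u - u') - (v - v')).
Proof.
by rewrite [- (v - v')]opprD [X in _ = _ + X]addrACA -opprD [RHS]addrC subrK.
Qed.

Section ConvexCombination.
Context (R : realType) (V : lmodType R).
Implicit Types (l : R) (u v : V).

Lemma comb_subr l u v : l *: u + (1 - l) *: v - u = (1 - l) *: (v - u).
Proof.
by rewrite scalerBr -addrA addrCA [(1 - l) *: u]scalerBl scale1r opprB.
Qed.

Lemma comb_subl l u v : v - (l *: u + (1 - l) *: v) = l *: (v - u).
Proof.
by rewrite [(1 - l) *: v]scalerBl scale1r opprD addrCA subKr addrC scalerBr.
Qed.

Lemma comb_sub l u v (z : V) :
  (1 - l) *: (v - z) - l *: (z - u) = l *: u + (1 - l) *: v - z.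
Proof.
rewrite (scalerBr (1 - l)) (scalerBr l) opprB addrACA -opprD -scalerDl subrK.
by rewrite scale1r [_ + l *: u]addrC.
Qed.

End ConvexCombination.

(** * Bruck's inequality: two points, finitely many, arbitrarily many *)

Section Bruck.
Context (R : realType) (X : normedModType R) (C : set X) (b : R) (eta : R -> R).
Hypothesis C_convex : convex_set C.
Hypothesis b_gt0 : 0 < b.
Hypothesis C_bounded : forall y, C y -> `|y| <= b / 2.
Hypothesis eta_mod : convexity_modulus X eta.

Lemma gamma2_gt0 t : 0 < t -> 0 < gamma2 b eta t.
Proof.
move=> t0; rewrite lt_min t0 mulr_gt0 ?divr_gt0 ?(eta_gt0 eta_mod) //.
by rewrite divr_gt0 ?mulr_gt0.
Qed.

Lemma gamma_from2_gt0 k t : 0 < t -> 0 < gamma_from2 b eta k t.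
Proof.
elim: k t => [|k IH] t t0 /=; first exact: gamma2_gt0.
by rewrite lt_min IH // gamma2_gt0 // divr_gt0 // IH // divr_gt0.
Qed.

Lemma gamma_from2_le k t : gamma_from2 b eta k t <= t.
Proof.
by elim: k => [|k IH] /=; rewrite ge_min ?lexx ?IH.
Qed.

Lemma gamma_gt0 c q t : 0 < t -> 0 < gamma b c q eta t.
Proof. by move=> t0; rewrite /gamma gt_eqF // gamma_from2_gt0 // divr_gt0. Qed.

Lemma diam_le u v : C u -> C v -> `|u - v| <= b.
Proof.
move=> /C_bounded Cu /C_bounded Cv.
by apply: le_trans (ler_normB _ _) _; lra.
Qed.

Context (S : X -> X).
Hypothesis S_maps : forall y, C y -> C (S y).
Hypothesis S_nonexp : nonexpansive_on C S.

(** The increments of [S] on the two pieces of the segment, divided by the lengths of the pieces,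
    lie in the unit ball. Their combination is [(S v - S u) / d] and their difference is the defect
    divided by [s = l (1 - l) d], so a large defect makes [S u] and [S v] markedly closer than [u]
    and [v]. *)
Lemma bruck_two (u v : X) (l t : R) : C u -> C v -> 0 <= l <= 1 -> 0 < t ->
    `|u - v| - `|S u - S v| < gamma2 b eta t ->
  `|S (l *: u + (1 - l) *: v) - (l *: S u + (1 - l) *: S v)| < t.
Proof.
move=> Cu Cv l01 t0; set z := l *: u + _; set z' := l *: S u + _.
set tau := `|S z - z'|.
move=> small; rewrite ltNge; apply/negP => t_tau; move: small.
apply/negP; rewrite -leNgt ge_min; apply/orP; right.
have Cz : C z by exact: convex_set_comb.
have tau0 : 0 < tau by exact: lt_le_trans t_tau.
set d := `|u - v|.
(* In the degenerate cases [u = v], [l = 0] and [l = 1] the defect [tau] vanishes, against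
   [t <= tau]. *)
have d_gt0 : 0 < d.
  rewrite lt_def normr_ge0 andbT normr_eq0 subr_eq0; apply/eqP => uv.
  move: tau0; rewrite /tau /z /z' uv -!scalerDl [l + _]addrC subrK !scale1r.
  by rewrite subrr normr0 ltxx.
have d_le : d <= b by exact: diam_le.
have l_neq0 : l != 0.
  apply/eqP => l0; move: tau0; rewrite /tau /z /z' l0 subr0.
  by rewrite !scale0r !scale1r !add0r subrr normr0 ltxx.
have l_neq1 : 1 - l != 0.
  rewrite subr_eq0; apply/eqP => l1; move: tau0; rewrite /tau /z /z' -l1 subrr.
  by rewrite !scale0r !scale1r !addr0 subrr normr0 ltxx.
have l_gt0 : 0 < l by lra.
have l_lt1 : 0 < 1 - l by lra.
have zu : z - u = (1 - l) *: (v - u) by exact: comb_subr.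
have vz : v - z = l *: (v - u) by exact: comb_subl.
pose s := l * (1 - l) * d.
have s_gt0 : 0 < s by rewrite !mulr_gt0.
(* This bound lets [eta_scale] replace the unknown [s] by [b / 4], whence the argument [4 * t / b]
   in [gamma2]. *)
have s_le : s <= b / 4.
  have : l * (1 - l) <= 4^-1.
    by have := sqr_ge0 (l - 2^-1); rewrite expr2; lra.
  by move=> /(ler_wpM2r (ltW d_gt0)); rewrite -/s; lra.
pose u' := (l * d)^-1 *: (S v - S z).
pose v' := ((1 - l) * d)^-1 *: (S z - S u).
have u'1 : `|u'| <= 1.
  rewrite normrZ gtr0_norm ?invr_gt0 ?mulr_gt0 // ler_pdivrMl ?mulr_gt0 //.
  apply: le_trans (S_nonexp Cv Cz) _.
  by rewrite vz normrZ mulr1 distrC gtr0_norm.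
have v'1 : `|v'| <= 1.
  rewrite normrZ gtr0_norm ?invr_gt0 ?mulr_gt0 // ler_pdivrMl ?mulr_gt0 //.
  apply: le_trans (S_nonexp Cz Cu) _.
  by rewrite zu normrZ mulr1 [`|v - u|]distrC gtr0_norm.
have uv_comb : l *: u' + (1 - l) *: v' = d^-1 *: (S v - S u).
  rewrite !scalerA !invfM !mulrA !divff // !mul1r -scalerDr; congr (_ *: _).
  by rewrite addrA subrK.
have uv_diff : u' - v' = s^-1 *: (z' - S z).
  rewrite /u' /v' /z' -comb_sub [RHS]scalerBr !scalerA.
  by congr (_ *: _ - _ *: _); rewrite /s; field; rewrite l_neq0 l_neq1 gt_eqF.
have := norm_comb_le eta_mod u'1 v'1 l01.
rewrite uv_comb uv_diff !normrZ !gtr0_norm ?invr_gt0 //.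
rewrite [`|z' - _|]distrC -/tau [s^-1 * _]mulrC ler_pdivrMl // => Suv.
have eta2 := eta_scale eta_mod (ltW tau0) s_gt0 s_le.
have tau_b : tau / (b / 4) = 4 * tau / b.
  by rewrite invfM invrK mulrA mulrC mulrA.
have eta1 : eta (4 * t / b) <= eta (4 * tau / b).
  apply: (eta_le eta_mod); first by rewrite divr_ge0 ?mulr_ge0 // ltW.
  by rewrite ler_pM2r ?invr_gt0 // ler_pM2l.
rewrite tau_b in eta2.
have eta3 : b / 2 * eta (4 * t / b) <= 2 * (b / 4 * eta (4 * tau / b)) by nra.
have -> : `|S u - S v| = `|S v - S u| by exact: distrC.
have e : d * (2 * (l * (1 - l)) * eta (tau / s)) = 2 * (s * eta (tau / s)).
  by rewrite /s; ring.
rewrite mulrBr mulr1 e in Suv; rewrite -/d; lra.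
Qed.

(** Induction on the number of points: [t / 2] goes to the induction hypothesis for the merged
    points, and at most [t / 6] to the merging itself. *)
Lemma bruck_from2 (k : nat) (t : R) (w : 'I_k.+2 -> R) (y : 'I_k.+2 -> X) :
    (forall i, 0 <= w i) -> \sum_i w i = 1 -> (forall i, C (y i)) -> 0 < t ->
    (forall i j, `|y i - y j| - `|S (y i) - S (y j)| < gamma_from2 b eta k t) ->
  `|S (\sum_i w i *: y i) - \sum_i w i *: S (y i)| < t.
Proof.
elim: k t w y => [|k IH] t w y w_ge0 w_sum1 Cy t0 gap.
  move: w_sum1; rewrite !big_ord_recl !big_ord0 /= !addr0 => w_sum1.
  have -> : w (lift ord0 ord0) = 1 - w ord0.
    by rewrite -w_sum1 addrAC subrr add0r.
  have w0 := w_ge0 ord0; have w1 := w_ge0 (lift ord0 ord0).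
  by apply: bruck_two => //; lra.
set l := w ord0.
have w_lift : \sum_(i < k.+2) w (lift ord0 i) = 1 - l.
  by rewrite -w_sum1 [in RHS]big_ord_recl addrAC subrr add0r.
have l_ge0 : 0 <= l by exact: w_ge0.
have l_le1 : 0 <= 1 - l by rewrite -w_lift sumr_ge0.
rewrite big_ord_recl [X in _ - X]big_ord_recl -/l.
have [l1|l_neq1] := eqVneq (1 - l) 0.
  have w0 i : w (lift ord0 i) = 0.
    by rewrite l1 in w_lift; exact: (psumr_eq0P _ w_lift).
  rewrite !big1 ?addr0 => [|i _|i _]; rewrite ?w0 ?scale0r //.
  have -> : l = 1 by lra.
  by rewrite !scale1r subrr normr0.
have l_lt1 : 0 < 1 - l by rewrite lt_neqAle eq_sym l_neq1.
(* Merging the first point into each of the others gives [k.+2] points [y' i]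
   with the same combination; [bruck_two] compares [S (y' i)] with [Sy' i]. *)
pose m i := w (lift ord0 i) / (1 - l).
have m_ge0 i : 0 <= m i by rewrite divr_ge0.
have m_sum1 : \sum_i m i = 1 by rewrite -mulr_suml w_lift divff.
pose y' i := l *: y ord0 + (1 - l) *: y (lift ord0 i).
pose Sy' i := l *: S (y ord0) + (1 - l) *: S (y (lift ord0 i)).
have sum_comb (F : 'I_k.+3 -> X) :
    l *: F ord0 + \sum_(i < k.+2) w (lift ord0 i) *: F (lift ord0 i) =
    \sum_i m i *: (l *: F ord0 + (1 - l) *: F (lift ord0 i)).
  under [RHS]eq_bigr do rewrite scalerDr scalerA.
  rewrite big_split /= -scaler_suml -mulr_suml m_sum1 mul1r; congr (_ + _).
  by apply: eq_bigr => i _; rewrite scalerA divfK.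
rewrite (sum_comb y) (sum_comb (S \o y)) /= -/y'.
set z := \sum_i m i *: y' i.
(* The gap of two merged points has three contributions, each at most [r]: the gap of the original
   points and two errors from [bruck_two]. *)
pose r := gamma_from2 b eta k (t / 2) / 3.
have r_gt0 : 0 < r by rewrite divr_gt0 // gamma_from2_gt0 // divr_gt0.
have gap_le i j : `|y i - y j| - `|S (y i) - S (y j)| < gamma2 b eta r.
  by apply: lt_le_trans (gap i j) _; rewrite /= ge_min lexx orbT.
have gamma2_le : gamma2 b eta r <= r by rewrite /gamma2 ge_min lexx.
have Sy'_close i : `|S (y' i) - Sy' i| < r.
  by apply: bruck_two => //; rewrite l_ge0 /=; lra.
have Cy' i : C (y' i).
  by apply: convex_set_comb => //; rewrite l_ge0 /=; lra.
have z_close : `|S z - \sum_i m i *: S (y' i)| < t / 2.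
  apply: IH => // [|i j]; first by rewrite divr_gt0.
  have y'E : y' i - y' j = (1 - l) *: (y (lift ord0 i) - y (lift ord0 j)).
    by rewrite /y' opprD addrACA subrr add0r -scalerBr.
  have Sy'E : Sy' i - Sy' j =
      (1 - l) *: (S (y (lift ord0 i)) - S (y (lift ord0 j))).
    by rewrite /Sy' opprD addrACA subrr add0r -scalerBr.
  have Sy'_le : `|Sy' i - Sy' j| <= `|S (y' i) - S (y' j)| + (r + r).
    rewrite (sub_decomp _ _ (S (y' i)) (S (y' j))).
    apply: le_trans (ler_normD _ _) _; rewrite lerD2l.
    apply: le_trans (ler_normB _ _) _.
    by rewrite lerD // distrC ltW.
  have gap1 := gap_le (lift ord0 i) (lift ord0 j).
  have gap0 : 0 <= `|y (lift ord0 i) - y (lift ord0 j)|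
      - `|S (y (lift ord0 i)) - S (y (lift ord0 j))|.
    by rewrite subr_ge0; exact: S_nonexp.
  move: Sy'_le; rewrite y'E Sy'E !normrZ gtr0_norm //.
  have -> : gamma_from2 b eta k (t / 2) = 3 * r by rewrite /r; field.
  have := ler_wpM2r gap0 (_ : 1 - l <= 1); rewrite mul1r => /(_ _); nra.
have Sz_close : `|\sum_i m i *: S (y' i) - \sum_i m i *: Sy' i| <= r.
  rewrite -sumrB -[r]mul1r -m_sum1 mulr_suml.
  apply: le_trans (ler_norm_sum _ _ _) _; apply: ler_sum => i _.
  by rewrite -scalerBr normrZ ger0_norm // ler_wpM2l // ltW.
have r_le : 6 * r <= t.
  by have := gamma_from2_le k (t / 2); rewrite /r; lra.
have -> : S z - \sum_i m i *: Sy' i = (S z - \sum_i m i *: S (y' i)) +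
    (\sum_i m i *: S (y' i) - \sum_i m i *: Sy' i) by rewrite addrA subrK.
by apply: le_lt_trans (ler_normD _ _) _; lra.
Qed.

Context (c q : R).
Hypothesis c_gt0 : 0 < c.
Hypothesis q_gt1 : 1 < q.
Hypothesis cq_type : type_inequality X c q.

(** With [p] samples of norm at most [sqrt 2 * b], Maurey's bound is at most [(p * t / 3) ^ q]
    exactly when [B ^ q <= p ^ (q - 1)]; this dictates the exponent in [gamma_index]. *)
Lemma gamma_index_ge (t : R) (B := 6 * b * c / (Num.sqrt 2 * t)) : 0 < t ->
  B `^ q <= (gamma_index b c q t)%:R `^ (q - 1).
Proof.
move=> t0; have B_gt0 : 0 < B.
  by rewrite divr_gt0 ?mulr_gt0 ?sqrtr_gt0.
have -> : B `^ q = (B `^ (q / (q - 1))) `^ (q - 1).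
  by rewrite -powRrM divfK // subr_eq0 gt_eqF.
apply: ge0_ler_powR; rewrite ?nnegrE ?powR_ge0 ?ler0n ?subr_ge0 ?(ltW q_gt1) //.
rewrite /gamma_index -/B.
by rewrite (le_trans (nceil_ge _)) // ler_nat leq_maxr.
Qed.

(** Centred pairs in [X * X] are sampled, so that one selection [f] serves both families. *)
Lemma maurey_approximation (t : R) (I : finType) (w : I -> R) (y z : I -> X) :
    (forall i, 0 <= w i) -> \sum_i w i = 1 ->
    (forall i, C (y i)) -> (forall i, C (z i)) -> 0 < t ->
  exists f : 'I_(gamma_index b c q t) -> I,
    let mean (u : I -> X) := (gamma_index b c q t)%:R^-1 *: \sum_j u (f j) in
    `|mean y - \sum_i w i *: y i| <= t / 3 /\
    `|mean z - \sum_i w i *: z i| <= t / 3.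
Proof.
move=> w_ge0 w_sum1 Cy Cz t0.
set my := \sum_i w i *: y i; set mz := \sum_i w i *: z i.
have Cmy : C my by exact: convex_set_sum.
have Cmz : C mz by exact: convex_set_sum.
pose v i := (y i - my, z i - mz).
have centered (u : I -> X) :
    \sum_i w i *: (u i - \sum_j w j *: u j) = 0.
  under eq_bigr do rewrite scalerBr.
  by rewrite sumrB -scaler_suml w_sum1 scale1r subrr.
have sum_pair (J : finType) (u u' : J -> X) :
    \sum_j (u j, u' j) = (\sum_j u j, \sum_j u' j) :> X * X.
  by elim: (index_enum J) => [|j s IH]; rewrite ?big_nil ?big_cons ?IH.
have v_mean : \sum_i w i *: v i = 0.
  transitivity (\sum_i (w i *: (y i - my), w i *: (z i - mz))) => //.
  by rewrite sum_pair !centered.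
(* Each component is a difference of two points of [C], hence at most [b] in norm. *)
have v_bound i : norm2 (v i) <= Num.sqrt 2 * b.
  rewrite /norm2 /= -[b]gtr0_norm // -sqrtr_sqr -sqrtrM // ler_wsqrtr //.
  have := diam_le (Cy i) Cmy; have := diam_le (Cz i) Cmz.
  have := normr_ge0 (y i - my); have := normr_ge0 (z i - mz); nra.
set p := gamma_index b c q t.
have p_gt0N : (0 < p)%N by rewrite (leq_trans _ (leq_maxl _ _)).
have p_gt0 : 0 < p%:R :> R by rewrite ltr0n.
have [f] := maurey_selection q_gt1 cq_type w_ge0 w_sum1 p v_mean v_bound.
set V := \sum_j _ => V_le.
have V_small : norm2 V <= p%:R * (t / 3).
  rewrite leNgt; apply/negP => V_gt; move: V_le; apply/negP; rewrite -ltNge.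
  have q_gt0 : 0 < q by exact: lt_trans q_gt1.
  have [b_ge0 c_ge0 t_ge0] := And3 (ltW b_gt0) (ltW c_gt0) (ltW t0).
  apply: (@le_lt_trans _ _ ((p%:R * (t / 3)) `^ q)); last first.
    by apply: gt0_ltr_powR; rewrite ?nnegrE ?sqrtr_ge0 ?mulr_ge0 ?ler0n.
  rewrite powRM ?ler0n ?divr_ge0 // -(mulr_powRB1 (ler0n _ p) q_gt0).
  rewrite -mulrA mulrCA.
  rewrite ler_pM2l // -powRM ?mulr_ge0 ?sqrtr_ge0 //.
  have -> : c * (Num.sqrt 2 * b) = 6 * b * c / (Num.sqrt 2 * t) * (t / 3).
    have sqrt2 : Num.sqrt 2 * Num.sqrt 2 = 2 :> R by rewrite -expr2 sqr_sqrtr.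
    have sqrt2_neq0 : Num.sqrt 2 != 0 :> R by rewrite gt_eqF // sqrtr_gt0.
    apply: (mulfI sqrt2_neq0).
    have -> : Num.sqrt 2 * (c * (Num.sqrt 2 * b)) =
      Num.sqrt 2 * Num.sqrt 2 * b * c by ring.
    rewrite sqrt2.
    by field; rewrite sqrt2_neq0 gt_eqF.
  rewrite powRM // ?divr_ge0 ?mulr_ge0 ?sqrtr_ge0 //.
  by rewrite ler_wpM2r ?powR_ge0 // gamma_index_ge.
exists f => mean.
have fst_le : `|V.1| <= norm2 V.
  by rewrite -[leLHS]normr_id -sqrtr_sqr ler_wsqrtr // lerDl sqr_ge0.
have snd_le : `|V.2| <= norm2 V.
  by rewrite -[leLHS]normr_id -sqrtr_sqr ler_wsqrtr // lerDr sqr_ge0.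
have VE1 : V.1 = \sum_j (y (f j) - my) by rewrite /V sum_pair.
have VE2 : V.2 = \sum_j (z (f j) - mz) by rewrite /V sum_pair.
by split; rewrite mean_sub // -?VE1 -?VE2 normrZ gtr0_norm ?invr_gt0 //
  ler_pdivrMl //; [exact: le_trans V_small | exact: le_trans V_small].
Qed.

(** The combination is replaced by an empirical mean [u] of [gamma_index t] points.
    Nonexpansiveness, [bruck_from2] at [u], and the approximation of the images each cost
    [t / 3]. *)
Lemma bruck (t : R) (I : finType) (w : I -> R) (y : I -> X) :
    (forall i, 0 <= w i) -> \sum_i w i = 1 -> (forall i, C (y i)) -> 0 < t ->
    (forall i j, `|y i - y j| - `|S (y i) - S (y j)| < gamma b c q eta t) ->
  `|S (\sum_i w i *: y i) - \sum_i w i *: S (y i)| < t.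
Proof.
move=> w_ge0 w_sum1 Cy t0; rewrite /gamma gt_eqF //.
have := maurey_approximation w_ge0 w_sum1 Cy (fun i => S_maps (Cy i)) t0.
have : (2 <= gamma_index b c q t)%N by exact: leq_maxl.
(* The index is at least 2, so the truncated subtraction in [gamma] is exact and leaves [k] for
   [k.+2] points. *)
case: (gamma_index b c q t) => [|[|k]] //= _ [f [y_close Sy_close]].
rewrite subn2 /= => gap.
set my := \sum_i w i *: y i in y_close *.
set mSy := \sum_i w i *: S (y i) in Sy_close *.
set u := _ *: _ in y_close; set u' := _ *: _ in Sy_close.
have uE : u = \sum_j k.+2%:R^-1 *: y (f j) by rewrite /u scaler_sumr.
have u'E : u' = \sum_j k.+2%:R^-1 *: S (y (f j)) by rewrite /u' scaler_sumr.
have k_sum1 : \sum_(j < k.+2) k.+2%:R^-1 = 1 :> R.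
  by rewrite sumr_const card_ord -[LHS]mulr_natr mulVf ?pnatr_eq0.
have Cu : C u by rewrite uE; exact: convex_set_sum.
have mid : `|S u - u'| < t / 3.
  rewrite uE u'E; apply: bruck_from2 => //; first by rewrite divr_gt0.
have -> : S my - mSy = (S my - S u) + ((S u - u') + (u' - mSy)).
  by rewrite !subrKA.
apply: le_lt_trans (ler_normD _ _) _.
have := ler_normD (S u - u') (u' - mSy).
have : `|S my - S u| <= t / 3.
  apply: le_trans y_close; rewrite distrC; apply: S_nonexp => //.
  exact: convex_set_sum.
lra.
Qed.

End Bruck.

(** * Cesaro means along the orbit *)

Lemma mean_close (R : realType) (X : normedModType R) (l : nat) (u : nat -> X)
    (z : X) (r : R) : (0 < l)%N -> (forall j, (j < l)%N -> `|u j - z| <= r) ->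
  `|l%:R^-1 *: (\sum_(j < l) u j) - z| <= r.
Proof.
move=> l_gt0 u_close; have l0 : 0 < l%:R :> R by rewrite ltr0n.
rewrite mean_sub // normrZ gtr0_norm ?invr_gt0 // ler_pdivrMl //.
apply: le_trans (ler_norm_sum _ _ _) _; rewrite mulr_natl.
rewrite -[X in r *+ X]card_ord -sumr_const.
by apply: ler_sum => j _; exact: u_close.
Qed.

Section ErgodicMeans.
Context (R : realType) (X : normedModType R) (C : set X) (b : R) (T : X -> X).
Hypothesis C_convex : convex_set C.
Hypothesis b_gt0 : 0 < b.
Hypothesis C_bounded : forall y, C y -> `|y| <= b / 2.
Hypothesis T_maps : forall y, C y -> C (T y).
Hypothesis T_nonexp : nonexpansive_on C T.

Lemma iter_maps k y : C y -> C (iter k T y).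
Proof. by move=> Cy; elim: k => //= k IH; exact: T_maps. Qed.

Lemma iter_nonexp k : nonexpansive_on C (iter k T).
Proof.
move=> y z Cy Cz; elim: k => //= k IH; apply: le_trans IH.
by apply: T_nonexp; exact: iter_maps.
Qed.

Context (x : X).
Hypothesis Cx : C x.

Local Notation orb k := (iter k T x).
Local Notation M n k := (ergodic_mean T n (iter k T x)).

Lemma ergodic_mean_orbit n k : M n k = n%:R^-1 *: \sum_(i < n) orb (k + i).
Proof.
rewrite /ergodic_mean; congr (_ *: _); apply: eq_bigr => i _.
by rewrite -iterD addnC.
Qed.

Lemma orb_in k : C (orb k).
Proof. exact: iter_maps. Qed.

Lemma ergodic_mean_in n k : (0 < n)%N -> C (M n k).
Proof.
move=> n_gt0; rewrite ergodic_mean_orbit scaler_sumr.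
apply: convex_set_sum => //= [|i]; last exact: orb_in.
by rewrite sumr_const card_ord -[LHS]mulr_natr mulVf // pnatr_eq0 -lt0n.
Qed.

(** A shift by one telescopes to a difference of two orbit points over [l], at most [b / l]. *)
Lemma ergodic_mean_shift l r s : (0 < l)%N ->
  `|M l (r + s) - M l r| <= s%:R * b / l%:R.
Proof.
move=> l_gt0; have l0 : 0 < l%:R :> R by rewrite ltr0n.
elim: s => [|s IH]; first by rewrite addn0 subrr normr0 !mul0r.
rewrite -[leLHS](_ : `|(M l (r + s.+1) - M l (r + s)) +
  (M l (r + s) - M l r)| = _); last by rewrite subrKA.
apply: le_trans (ler_normD _ _) _.
rewrite -natr1 !mulrDl addrC lerD // mul1r.
rewrite !ergodic_mean_orbit -scalerBr -sumrB normrZ gtr0_norm ?invr_gt0 //.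
rewrite mulrC ler_wpM2r ?invr_ge0 ?ler0n //.
under eq_bigr do rewrite addnS addSnnS.
rewrite -(big_mkord xpredT (fun i => orb (r + s + i.+1) - orb (r + s + i))).
rewrite telescope_sumr // addn0.
by apply: (diam_le C_bounded); exact: orb_in.
Qed.

(** Exchanging the two averages leaves [n] means of length [l], each shifted from [M l k] by less
    than [s + n]. *)
Lemma ergodic_mean_means l n k s : (0 < l)%N -> (0 < n)%N ->
  `|l%:R^-1 *: (\sum_(j < l) M n (k + s + j)) - M l k|
    <= (s + n)%:R * b / l%:R.
Proof.
move=> l_gt0 n_gt0.
have -> : l%:R^-1 *: (\sum_(j < l) M n (k + s + j)) =
    n%:R^-1 *: \sum_(i < n) M l (k + (s + i)).
  under eq_bigr do rewrite ergodic_mean_orbit.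
  under [in RHS]eq_bigr do rewrite ergodic_mean_orbit.
  rewrite -!scaler_sumr !scalerA mulrC exchange_big /=.
  congr (_ *: _); apply: eq_bigr => i _; apply: eq_bigr => j _.
  by rewrite addnA addnAC.
apply: (mean_close (u := fun i => M l (k + (s + i)))) => // i lt_in.
apply: le_trans (ergodic_mean_shift _ _ l_gt0) _.
by rewrite ler_pM2r ?invr_gt0 ?ltr0n // ler_pM2r // ler_nat leq_add2l ltnW.
Qed.

(** The case [m = n] is commutation with a single mean. *)
Definition is_commutation_rate (B : rate R) : Prop :=
  forall (eps : R) (g h : nat -> nat), 0 < eps ->
    exists2 N : nat, (N <= B eps g h)%N &
      forall m n k : nat, (0 < m)%N -> (0 < n)%N ->
        (N <= m <= N + g N)%N -> (N <= n <= N + g N)%N -> (k <= h N)%N ->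
        `|iter k T (2^-1 *: (M m m + M n n))
          - 2^-1 *: (M m (m + k) + M n (n + k))| < eps.

(** The midpoint is one convex combination of orbit points, indexed by a disjoint sum, and [bruck]
    applies to it with the map [T ^ k]. *)
Lemma rateB_commutation (eta : R -> R) (c q : R) (A : rate R) :
    convexity_modulus X eta -> 0 < c -> 1 < q -> type_inequality X c q ->
    is_alpha_rate T x A ->
  is_commutation_rate (rateB b c q eta A).
Proof.
move=> eta_mod c_gt0 q_gt1 cq_type A_rate eps g h eps_gt0.
have [N N_le alpha_close] := A_rate _ (fun N => N + 2 * g N + h N)%N
  (fun N => 2 * (N + g N))%N (gamma_gt0 b_gt0 eta_mod c q eps_gt0).
exists N => // m n k m_gt0 n_gt0 /andP[Nm mN] /andP[Nn nN] kh.
pose e (i : 'I_m + 'I_n) : nat :=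
  match i with inl i => m + i | inr j => n + j end%N.
have e_ge i : (N <= e i)%N by case: i => i /=; lia.
have e_le i : (e i < 2 * (N + g N))%N by case: i => -[i lt_i] /=; lia.
pose w (i : 'I_m + 'I_n) : R :=
  match i with inl _ => 2^-1 / m%:R | inr _ => 2^-1 / n%:R end.
have combE (F : nat -> X) : \sum_i w i *: F (e i) =
    2^-1 *: (m%:R^-1 *: (\sum_(i < m) F (m + i)%N)
           + n%:R^-1 *: (\sum_(i < n) F (n + i)%N)).
  by rewrite big_sumType /= -!scaler_sumr scalerDr !scalerA.
have w_ge0 i : 0 <= w i by case: i => i /=; rewrite divr_ge0 ?invr_ge0.
have w_sum1 : \sum_i w i = 1.
  rewrite big_sumType /= !sumr_const !card_ord.
  rewrite -(mulr_natr (2^-1 / m%:R)) -(mulr_natr (2^-1 / n%:R)).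
  by rewrite !divfK ?pnatr_eq0 -?lt0n //; field.
have := bruck C_convex b_gt0 C_bounded eta_mod (@iter_maps k) (@iter_nonexp k)
  c_gt0 q_gt1 cq_type w_ge0 w_sum1 (fun i => orb_in (e i)) eps_gt0.
rewrite (combE (fun i => orb i)) (combE (fun i => iter k T (orb i))).
rewrite !ergodic_mean_orbit.
have orb_shift l : \sum_(i < l) iter k T (orb (l + i)%N) =
    \sum_(i < l) orb (l + k + i)%N.
  by apply: eq_bigr => i _; rewrite -iterD; congr iter; lia.
rewrite !orb_shift; apply => i j.
wlog ij : i j / (e i <= e j)%N => [wlog_hyp|].
  have [/wlog_hyp//|/ltnW/wlog_hyp] := leqP (e i) (e j).
  by rewrite distrC [X in _ - X]distrC.
(* The gap is a change of [alpha] between [e i] and [k + e i], at most [2 N + 2 g N + h N], with lag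
   [e j - e i] at most [2 (N + g N)]: the two functions passed to [A] in [rateB]. *)
have := alpha_close (e i) (k + e i)%N (e j - e i)%N.
rewrite /alpha -[(k + e i + _)%N]addnA subnKC // !iterD => close.
have e_gei := e_ge i; have e_lei := e_le i; have e_lej := e_le j.
by apply: le_lt_trans (ler_norm _) (close _ _ _); lia.
Qed.

End ErgodicMeans.

(** * Metastability of the Cesaro means *)

Lemma maxfun_ge g m n : (m <= n)%N -> (g m <= maxfun g n)%N.
Proof.
move=> mn; rewrite /maxfun.
exact: (leq_bigmax (F := fun i : 'I_n.+1 => g i) (Ordinal (mn : m < n.+1)%N)).
Qed.

Lemma maxfun_mono g m n : (m <= n)%N -> (maxfun g m <= maxfun g n)%N.
Proof.
move=> mn; apply/bigmax_leqP => i _; apply: maxfun_ge.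
by have := ltn_ord i; lia.
Qed.

Lemma nceil_mono (R : realType) (s t : R) : 0 <= s -> s <= t ->
  (nceil s <= nceil t)%N.
Proof.
move=> s_ge0 st; rewrite -lez_nat !gez0_abs ?le_ceil ?ceil_ge0 //.
  exact: lt_le_trans (ltrN10 R) (le_trans s_ge0 st).
exact: lt_le_trans (ltrN10 R) s_ge0.
Qed.

Lemma half_double (R : realType) (V : lmodType R) (u : V) :
  2^-1 *: (u + u) = u :> V.
Proof. by rewrite -{1 2}[u]scale1r -scalerDl scalerA mulVf ?scale1r. Qed.

(** * Growth of the candidate intervals *)

Section GrowthStep.
Context (R : realType) (b eps : R) (g : nat -> nat).
Hypothesis b_gt0 : 0 < b.
Hypothesis eps_gt0 : 0 < eps.

(** The inner [n'] of [gstep]: a mean of at least this length absorbs a shift by [n] with error at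
    most [eps / 4]. *)
Definition gstart (n : nat) : nat := maxn n (nceil (4 * n%:R * b / eps)).

Lemma gstart_mono m n : (m <= n)%N -> (gstart m <= gstart n)%N.
Proof.
move=> mn; rewrite /gstart.
have : (nceil (4 * m%:R * b / eps) <= nceil (4 * n%:R * b / eps))%N.
  apply: nceil_mono; first by rewrite divr_ge0 ?mulr_ge0 ?ler0n // ltW.
  by rewrite ler_pM2r ?invr_gt0 // ler_pM2r // ler_pM2l // ler_nat.
lia.
Qed.

Lemma gstart_ge n : (n <= gstart n)%N.
Proof. exact: leq_maxl. Qed.

Lemma gstart_bound n : n%:R * b <= eps / 4 * (gstart n)%:R.
Proof.
have : 4 * n%:R * b / eps <= (gstart n)%:R.
  by rewrite (le_trans (nceil_ge _)) // ler_nat leq_maxr.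
rewrite ler_pdivrMr //; lra.
Qed.

Lemma gstep_mono m n : (m <= n)%N -> (gstep b eps g m <= gstep b eps g n)%N.
Proof. by move=> /gstart_mono mn; rewrite leq_add // maxfun_mono. Qed.

Lemma gstart_step n : (gstart n + g (gstart n) <= gstep b eps g n)%N.
Proof. by rewrite leq_add2l maxfun_ge. Qed.

Lemma gstep_ge n : (n <= gstep b eps g n)%N.
Proof. by have := gstart_step n; have := gstart_ge n; lia. Qed.

Lemma giter_mono i m n : (m <= n)%N ->
  (giter b eps g i m <= giter b eps g i n)%N.
Proof.
move=> mn; rewrite /giter; elim: i => [|i IH]; last exact: gstep_mono.
by rewrite geq_max leq_maxl leq_max mn orbT.
Qed.

Lemma giter_ge i j n : (i <= j)%N -> (giter b eps g i n <= giter b eps g j n)%N.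
Proof.
move=> /subnKC <-; elim: (j - i)%N => [|k IH]; first by rewrite addn0.
by rewrite addnS; apply: leq_trans IH _; exact: gstep_ge.
Qed.

Lemma giter_ge_start i n : (maxn 1 n <= giter b eps g i n)%N.
Proof. exact: (giter_ge n (leq0n i)). Qed.

End GrowthStep.

(** * Metastability of the distances to a fixed point *)

Section NormStability.
Context (R : realType) (X : normedModType R) (C : set X) (b : R) (T : X -> X).
Hypothesis C_convex : convex_set C.
Hypothesis b_gt0 : 0 < b.
Hypothesis C_bounded : forall y, C y -> `|y| <= b / 2.
Hypothesis T_maps : forall y, C y -> C (T y).
Hypothesis T_nonexp : nonexpansive_on C T.
Context (x : X) (B : rate R).
Hypothesis Cx : C x.
Hypothesis B_rate : is_commutation_rate T x B.
Context (p : X).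
Hypothesis Cp : C p.
Hypothesis Tp : T p = p.

Local Notation M n k := (ergodic_mean T n (iter k T x)).
Local Notation a n := (`|M n n - p|).

Lemma iter_dist_fix k y : C y -> `|iter k T y - p| <= `|y - p|.
Proof.
move=> Cy; have {1}<- : iter k T p = p by elim: k => //= k ->.
exact: (iter_nonexp T_maps T_nonexp).
Qed.

(** The mean [M m m] is within [eps / 4] of the average of the [M l (m + j)]; each of these is
    within [eps / 4] of an iterate of [M l l], which is no farther from [p] than [M l l]. *)
Lemma dist_fix_descent (l m : nat) (eps : R) : (0 < l)%N -> (l <= m)%N ->
    l%:R * b <= eps / 4 * m%:R ->
    (forall k, (k <= 2 * m)%N ->
      `|iter k T (M l l) - M l (l + k)| <= eps / 4) ->
  a m <= a l + eps / 2.
Proof.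
move=> l_gt0 lm lm_bound comm; have m_gt0 : (0 < m)%N by lia.
pose w := m%:R^-1 *: \sum_(j < m) M l (m + j).
have w_close : `|w - M m m| <= eps / 4.
  have := ergodic_mean_means b_gt0 C_bounded T_maps Cx m 0 m_gt0 l_gt0.
  rewrite addn0 add0n => /le_trans; apply.
  by rewrite ler_pdivrMr // ltr0n.
have : `|w - p| <= a l + eps / 4.
  apply: (mean_close (u := fun j => M l (m + j))) => // j jm.
  have := comm (m + j - l)%N; have -> : (l + (m + j - l) = m + j)%N by lia.
  move=> /(_ _)/= comm_j.
  rewrite -[M l _ - p](subrKA (iter (m + j - l) T (M l l))).
  apply: le_trans (ler_normD _ _) _; rewrite addrC lerD //.
    apply: iter_dist_fix; exact: (ergodic_mean_in C_convex).
  by rewrite distrC comm_j //; lia.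
have : a m <= `|w - M m m| + `|w - p|.
  by rewrite [`|w - M m m|]distrC -[X in `|X|](subrKA w) ler_normD.
lra.
Qed.

(** A single commutation interval is long enough to contain [K + 1] successive candidate intervals,
    one of which must be stable. *)
Lemma rateTheta_spec (eps : R) (g h : nat -> nat) : 0 < eps ->
  exists N : nat, [/\ (0 < N)%N, (N <= rateTheta b B eps g h)%N,
    forall m n : nat, (N <= m <= N + g N)%N -> (N <= n <= N + g N)%N ->
      a m - a n <= eps &
    forall m n k : nat, (N <= m <= N + g N)%N -> (N <= n <= N + g N)%N ->
      (k <= h N)%N ->
      `|iter k T (2^-1 *: (M m m + M n n))
        - 2^-1 *: (M m (m + k) + M n (n + k))| < eps / 4].
Proof.
move=> eps_gt0; pose K := nceil (2 * b / eps); pose G := giter b eps g.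
have eps4_gt0 : 0 < eps / 4 by rewrite divr_gt0.
have [N0 N0_le comm] := B_rate (G (K + 2)%N)
  (fun n => maxn (2 * G (K + 1)%N n) (maxfun h (G (K + 1)%N n)))%N eps4_gt0.
(* The [i]-th candidate starts at [N i] and lies between the checkpoints [v i] and [v i.+1]. *)
pose v i := G i N0; pose N i := gstart b eps (v i).
have {}comm m n k : (0 < m)%N -> (0 < n)%N -> (N0 <= m <= v K.+2)%N ->
    (N0 <= n <= v K.+2)%N -> (k <= maxn (2 * v K.+1) (maxfun h (v K.+1)))%N ->
    `|iter k T (2^-1 *: (M m m + M n n))
      - 2^-1 *: (M m (m + k) + M n (n + k))| < eps / 4.
  move=> m_gt0 n_gt0 m_in n_in k_le; apply: comm => //.
  - by rewrite addn2 -/(v K.+2); lia.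
  - by rewrite addn2 -/(v K.+2); lia.
  - by rewrite addn1.
have v_ge i : (maxn 1 N0 <= v i)%N by exact: giter_ge_start.
have v_mono i j : (i <= j)%N -> (v i <= v j)%N by exact: giter_ge.
have N_ge i : (v i <= N i)%N by exact: gstart_ge.
have N_step i : (N i + g (N i) <= v i.+1)%N by exact: gstart_step.
have stable : exists2 i, (i <= K)%N & forall m n : nat,
    (N i <= m <= N i + g (N i))%N -> (N i <= n <= N i + g (N i))%N ->
    a m - a n <= eps.
  (* Otherwise each of the [K.+1] unstable intervals lowers the least distance
     to [p] by [eps / 2], from at most [b] to below [0]. *)
  apply: contrapT => unstable.
  have descent i : (i <= K.+1)%N -> exists l : nat,
      [/\ (maxn 1 N0 <= l)%N, (l <= v i)%N & a l <= b - i%:R * (eps / 2)].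
    elim: i => [_|i IH iK].
      exists (v 0%N); split=> //; rewrite mul0r subr0.
      apply: (diam_le C_bounded) => //; apply: (ergodic_mean_in C_convex) => //.
      by have := v_ge 0%N; lia.
    have [l [l_ge l_le al]] := IH (ltnW iK).
    have [m [n [m_in n_in amn]]] : exists m n : nat,
        [/\ (N i <= m <= N i + g (N i))%N, (N i <= n <= N i + g (N i))%N &
            eps < a m - a n].
      apply: contrapT => no_pair; apply: unstable; exists i => // m n m_in n_in.
      by rewrite leNgt; apply/negP => amn; apply: no_pair; exists m, n.
    have vK := v_mono i.+1 K.+1 iK.
    have vK1 := v_mono K.+1 K.+2 (leqnSn _).
    have Ngei := N_ge i; have Nstepi := N_step i; have vgei := v_ge i.
    (* As [l <= v i], every [m >= N i] is long enough for the descent lemma. With [eps < a m - a n],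
       the index [n] becomes the next [l]. *)
    have am : a m <= a l + eps / 2.
      apply: dist_fix_descent; [lia|lia| |].
        apply: (@le_trans _ _ ((v i)%:R * b)).
          by rewrite ler_pM2r // ler_nat.
        apply: le_trans (gstart_bound b eps_gt0 (v i)) _.
        by rewrite ler_pM2l // ler_nat -/(N i); lia.
      move=> k km; have := comm l l k.
      rewrite !half_double => H.
      by apply/ltW/H; lia.
    exists n; split; [lia|lia|].
    by rewrite -natr1; lra.
  have [l [_ _ al]] := descent K.+1 (leqnn _).
  have := normr_ge0 (M l l - p); have : 2 * b / eps <= K%:R by exact: nceil_ge.
  rewrite ler_pdivrMr //; move: al; rewrite -natr1; lra.
have [i iK stable_i] := stable; exists (N i).
have vK := v_mono i.+1 K.+1 iK.
have vK1 := v_mono K.+1 K.+2 (leqnSn _).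
have Ngei := N_ge i; have Nstepi := N_step i; have vgei := v_ge i.
split=> //; first by lia.
  (* [v K.+1] iterates from [N0], while [rateTheta] iterates from the bound on [N0]; monotonicity in
     the start compares them. *)
  apply: (@leq_trans (v K.+1)); first by lia.
  by rewrite /v -addn1; apply: giter_mono.
move=> m n k m_in n_in kh.
have hN : (h (N i) <= maxfun h (v K.+1))%N by apply: maxfun_ge; lia.
by apply: comm; lia.
Qed.

End NormStability.

(** * From stable distances to metastable means *)

Section CesaroConvergence.
Context (R : realType) (X : normedModType R) (C : set X) (b : R) (T : X -> X).
Hypothesis C_convex : convex_set C.
Hypothesis b_gt0 : 0 < b.
Hypothesis C_bounded : forall y, C y -> `|y| <= b / 2.
Hypothesis T_maps : forall y, C y -> C (T y).
Hypothesis T_nonexp : nonexpansive_on C T.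
Context (x : X) (B : rate R).
Hypothesis Cx : C x.
Hypothesis B_rate : is_commutation_rate T x B.
Context (p : X).
Hypothesis Cp : C p.
Hypothesis Tp : T p = p.
Context (eta : R -> R).
Hypothesis eta_mod : convexity_modulus X eta.

Local Notation M n k := (ergodic_mean T n (iter k T x)).
Local Notation a n := (`|M n n - p|).

Lemma delta_gt0 eps : 0 < eps -> 0 < delta b eta eps.
Proof.
move=> eps_gt0; rewrite /delta !lt_min b_gt0 !mulr_gt0 ?divr_gt0 //=.
by rewrite (eta_gt0 eta_mod) // divr_gt0 ?mulr_gt0.
Qed.

(** Uniform convexity in the ball of radius [r] about [p] gains [r * eta (eps / r)]. By [eta_scale]
    this is at least [b * eta (eps / b)], and [eps <= 2 * b] bounds that below by [4 * delta]. *)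
Lemma mid_dist_fix (u v : X) (r eps : R) : 0 < eps -> r <= b ->
    `|u - p| <= r -> `|v - p| <= r -> eps <= `|u - v| ->
  `|2^-1 *: (u + v) - p| <= r - 4 * delta b eta eps.
Proof.
move=> eps_gt0 r_le_b ur vr uv.
have d_le_eta : delta b eta eps <= eps / 8 * eta (eps / (2 * b)).
  by rewrite /delta !ge_min lexx !orbT.
have uv_r : `|u - v| <= r + r.
  rewrite -[u - v](subrKA p); apply: le_trans (ler_normD _ _) _.
  by rewrite lerD // distrC.
have r_gt0 : 0 < r by lra.
have := norm_mid_le eta_mod r_gt0 ur vr.
rewrite addrACA -opprD scalerBr half_double opprB subrKA => /le_trans; apply.
rewrite lerD2l lerN2.
have eta_b : b * eta (eps / b) <= r * eta (eps / r).
  exact: (eta_scale eta_mod (ltW eps_gt0) r_gt0 r_le_b).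
have eta_r : r * eta (eps / r) <= r * eta (`|u - v| / r).
  rewrite ler_pM2l //; apply: (eta_le eta_mod).
    by rewrite divr_ge0 // ltW.
  by rewrite ler_pM2r ?invr_gt0.
have eta_2b : eta (eps / (2 * b)) <= eta (eps / b).
  apply: (eta_le eta_mod).
    by rewrite ltW // divr_gt0 ?mulr_gt0.
  by rewrite ler_pM2l // lef_pV2 ?posrE ?mulr_gt0 //; lra.
have eta_pos : 0 < eta (eps / (2 * b)).
  by rewrite (eta_gt0 eta_mod) // divr_gt0 ?mulr_gt0.
have : eps / 2 * eta (eps / (2 * b)) <= b * eta (eps / b).
  by apply: ler_pM => //; [lra|exact: ltW|lra].
lra.
Qed.

(** The offset [l] and the length [l] together cost [2 * l * b / L]. *)
Lemma ergodic_mean_far (l L : nat) (d : R) : (0 < l)%N -> (0 < L)%N ->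
    6 * b * l%:R <= d * L%:R ->
  `|L%:R^-1 *: (\sum_(j < L) M l (L + l + j)) - M L L| <= d / 3.
Proof.
move=> l_gt0 L_gt0 L_ge.
have := ergodic_mean_means b_gt0 C_bounded T_maps Cx L l L_gt0 l_gt0.
move=> /le_trans; apply.
by rewrite ler_pdivrMr ?ltr0n // natrD; lra.
Qed.

(** If two means were [eps] apart, with [r] the larger distance to [p], their midpoint would be
    within [r - 4 d] of [p], hence [a L <= r - 4 d + d / 4 + d / 3], whereas stability gives
    [r <= a L + d]. *)
Lemma rateDelta_spec (eps : R) (g h : nat -> nat) : 0 < eps ->
  exists N : nat, [/\ (0 < N)%N, (N <= rateDelta b eta B eps g h)%N,
    forall m n : nat, (N <= m <= N + g N)%N -> (N <= n <= N + g N)%N ->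
      `|M m m - M n n| < eps &
    forall n k : nat, (N <= n <= N + g N)%N -> (k <= h N)%N ->
      `|iter k T (M n n) - M n (n + k)| < eps / 16].
Proof.
move=> eps_gt0; pose d := delta b eta eps.
have d_gt0 : 0 < d by exact: delta_gt0.
have d_le_b : d <= b by rewrite /d /delta ge_min lexx.
have d_le_eps : d <= eps / 4 by rewrite /d /delta !ge_min lexx orbT.
pose g' n := nceil (6 * b * (n + g n)%N%:R / d).
have [N [N_gt0 N_le stable comm]] := rateTheta_spec C_convex b_gt0 C_bounded
  T_maps T_nonexp Cx B_rate Cp Tp (fun n => g n + g' n)%N
  (fun n => maxn (n + g n + 2 * g' n) (h n))%N d_gt0.
exists N; split=> //; last first.
  (* The case [m = n] of the commutation, whose error [d / 4] is at most [eps / 16]. *)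
  move=> n k n_in k_le; have := comm n n k.
  rewrite !half_double => comm_n.
  by apply: lt_le_trans (comm_n _ _ _) _; [lia..|lra].
(* [L] lies in the interval of stable distances, yet is long enough for averaging errors of at most
   [d / 3] for every [l <= N + g N]. *)
pose L := g' N.
have L_ge : 6 * b * (N + g N)%N%:R <= d * L%:R.
  by rewrite [leRHS]mulrC -ler_pdivrMr // nceil_ge.
have L_geN : (N + g N <= L)%N.
  rewrite -(ler_nat R) -(ler_pM2l d_gt0) (le_trans _ L_ge) //.
  by rewrite ler_wpM2r ?ler0n //; lra.
have L_gt0 : (0 < L)%N by lia.
have widen l : (N <= l <= N + g N)%N -> (N <= l <= N + (g N + L))%N by lia.
have L_in : (N <= L <= N + (g N + L))%N by lia.
move=> m n m_in n_in; rewrite ltNge; apply/negP => eps_le.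
have {}comm := comm m n _ (widen m m_in) (widen n n_in).
have m_stable : a m - a L <= d by exact: stable (widen m m_in) L_in.
have n_stable : a n - a L <= d by exact: stable (widen n n_in) L_in.
have Cm l : (0 < l)%N -> C (M l l) by exact: (ergodic_mean_in C_convex).
have a_le l : (0 < l)%N -> a l <= b.
  by move=> l_gt0; apply: (diam_le C_bounded) => //; exact: Cm.
have m_gt0 : (0 < m)%N by case/andP: m_in => /(leq_trans N_gt0).
have n_gt0 : (0 < n)%N by case/andP: n_in => /(leq_trans N_gt0).
have a_m := a_le m m_gt0; have a_n := a_le n n_gt0.
pose r := Num.max (a m) (a n).
have am_r : a m <= r by rewrite le_max lexx.
have an_r : a n <= r by rewrite le_max lexx orbT.
have r_le_b : r <= b by rewrite ge_max a_m a_n.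
pose z := 2^-1 *: (M m m + M n n).
have Cz : C z.
  have half : 1 - 2^-1 = 2^-1 :> R by field.
  rewrite /z scalerDr -[X in _ + X *: _]half.
  by apply: (convex_set_comb C_convex (Cm m m_gt0) (Cm n n_gt0)); lra.
have z_close : `|z - p| <= r - 4 * d by exact: mid_dist_fix.
(* Both means are shifted by the same [L + j], so [w j] approximates one iterate of the midpoint
   [z]. *)
pose w j := 2^-1 *: (M m (m + (L + j)) + M n (n + (L + j))).
have w_close j : (j < L)%N -> `|w j - p| <= r - 4 * d + d / 4.
  move=> jL; rewrite -[w j - p](subrKA (iter (L + j) T z)).
  apply: le_trans (ler_normD _ _) _; rewrite addrC; apply: lerD.
    by apply: le_trans z_close; exact: (iter_dist_fix T_maps T_nonexp Cp Tp).
  rewrite distrC; apply/ltW/comm => //.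
  have k_le : (L + j <= N + g N + 2 * L)%N by clear -jL; lia.
  exact: leq_trans k_le (leq_maxl _ _).
pose W := L%:R^-1 *: \sum_(j < L) w j.
have W_close : `|W - p| <= r - 4 * d + d / 4 by exact: (mean_close (u := w)).
have shift_err l : (N <= l <= N + g N)%N ->
    `|L%:R^-1 *: (\sum_(j < L) M l (L + l + j)) - M L L| <= d / 3.
  move=> l_in.
  have l_gt0 : (0 < l)%N by case/andP: l_in => /(leq_trans N_gt0).
  apply: ergodic_mean_far => //; apply: le_trans L_ge.
  by rewrite ler_pM2l ?mulr_gt0 // ler_nat; case/andP: l_in.
have WE : W - M L L =
    2^-1 *: ((L%:R^-1 *: (\sum_(j < L) M m (L + m + j)) - M L L)
           + (L%:R^-1 *: (\sum_(j < L) M n (L + n + j)) - M L L)).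
  rewrite addrACA -opprD scalerBr half_double; congr (_ - _).
  rewrite /W /w -scaler_sumr scalerA mulrC -scalerA -scalerDr -big_split /=.
  congr (_ *: (_ *: _)); apply: eq_bigr => j _.
  by rewrite !(addnCA _ L) !addnA.
have W_mean : `|W - M L L| <= d / 3.
  rewrite WE normrZ gtr0_norm ?invr_gt0 // ler_pdivrMl //.
  apply: le_trans (ler_normD _ _) _.
  by have := shift_err m m_in; have := shift_err n n_in; lra.
have aL : a L <= r - 4 * d + d / 4 + d / 3.
  rewrite -[M L L - p](subrKA W); apply: le_trans (ler_normD _ _) _.
  by rewrite addrC lerD // distrC.
have : r <= a L + d by rewrite ge_max; apply/andP; split; lra.
lra.
Qed.

(** The path runs from [M m m] through [M L L], [M L (L + k)], [T ^ k (M L L)] and [T ^ k (M n n)]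
    to [M n (n + k)], where [L] is so long that a shift by [k <= h N] moves its mean by at most
    [eps / 4]. Three steps cost [eps / 4] each and the two commutations [eps / 64] each. *)
Lemma ratePsi_spec (eps : R) (g h : nat -> nat) : 0 < eps ->
  exists N : nat, [/\ (0 < N)%N, (N <= ratePsi b eta B eps g h)%N &
    forall m n k : nat, (N <= m <= N + g N)%N -> (N <= n <= N + g N)%N ->
      (k <= h N)%N -> `|M m m - M n (n + k)| < eps].
Proof.
move=> eps_gt0; have eps4_gt0 : 0 < eps / 4 by rewrite divr_gt0.
pose g'' N := maxn (g N) (nceil (4 * b * (h N)%:R / eps)).
have [N [N_gt0 N_le cauchy comm]] := rateDelta_spec g'' h eps4_gt0.
exists N; split=> // m n k m_in n_in k_le; pose L := (N + g'' N)%N.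
have g_le : (g N <= g'' N)%N by exact: leq_maxl.
have L_gt0 : (0 < L)%N by rewrite /L; lia.
have mL : `|M m m - M L L| < eps / 4 by apply: cauchy; rewrite /L; lia.
have Ln : `|M L L - M n n| < eps / 4 by apply: cauchy; rewrite /L; lia.
have shift : `|M L (L + k) - M L L| <= eps / 4.
  apply: le_trans (ergodic_mean_shift C_bounded T_maps Cx _ _ L_gt0) _.
  rewrite ler_pdivrMr ?ltr0n //.
  have : 4 * b * (h N)%:R / eps <= L%:R.
    rewrite (le_trans (nceil_ge _)) // ler_nat.
    by rewrite (leq_trans (leq_maxr (g N) _)) // /L leq_addl.
  have : b * k%:R <= b * (h N)%:R by rewrite ler_pM2l // ler_nat.
  by rewrite ler_pdivrMr //; lra.
have comm_L : `|iter k T (M L L) - M L (L + k)| < eps / 4 / 16.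
  by apply: comm; rewrite /L; lia.
have comm_n : `|iter k T (M n n) - M n (n + k)| < eps / 4 / 16.
  by apply: comm; lia.
have T_Ln : `|iter k T (M L L) - iter k T (M n n)| <= `|M L L - M n n|.
  apply: (iter_nonexp T_maps T_nonexp); apply: (ergodic_mean_in C_convex) => //.
  by lia.
have := ler_distD (M L L) (M m m) (M n (n + k)).
have := ler_distD (M L (L + k)) (M L L) (M n (n + k)).
have := ler_distD (iter k T (M L L)) (M L (L + k)) (M n (n + k)).
have := ler_distD (iter k T (M n n)) (iter k T (M L L)) (M n (n + k)).
rewrite [`|M L L - M L (L + k)|]distrC.
rewrite [`|M L (L + k) - iter k T (M L L)|]distrC.
lra.
Qed.

(** An arbitrary start [k] is reached by averaging: [M n k] is within [eps / 3] of the average of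
    means of length [N0] with starts [N0 + (k + j)], each within [eps / 2] of [M m m]. *)
Lemma ratePhi_spec (eps : R) (g h : nat -> nat) : 0 < eps ->
  exists N : nat, [/\ (0 < N)%N, (N <= ratePhi b eta B eps g h)%N &
    forall m n k : nat, (N <= m <= N + g N)%N -> (N <= n <= N + g N)%N ->
      (k <= h N)%N -> `|M m m - M n k| < eps].
Proof.
move=> eps_gt0; have eps2_gt0 : 0 < eps / 2 by rewrite divr_gt0.
pose g' n := (Neps b eps n + g (Neps b eps n))%N.
pose h' n := (g' n + h (Neps b eps n))%N.
have [N0 [N0_gt0 N0_le close]] := ratePsi_spec g' h' eps2_gt0.
pose N := Neps b eps N0; have N0_N : (N0 <= N)%N by exact: leq_maxl.
exists N; split; first by lia.
  rewrite /ratePhi -/g' -/h'; move: N0_le.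
  set P := ratePsi _ _ _ _ _ _ => N0_le.
  have : (nceil (6 * N0%:R * b / eps) <= nceil (6 * P%:R * b / eps))%N.
    apply: nceil_mono; first by rewrite divr_ge0 ?mulr_ge0 ?ler0n // ltW.
    by rewrite ler_pM2r ?invr_gt0 // ler_pM2r // ler_pM2l // ler_nat.
  by rewrite /N /Neps; lia.
move=> m n k m_in n_in k_le; have n_gt0 : (0 < n)%N by lia.
pose w := n%:R^-1 *: \sum_(j < n) M N0 (k + N0 + j).
have w_mean : `|w - M n k| <= eps / 3.
  have := ergodic_mean_means b_gt0 C_bounded T_maps Cx k N0 n_gt0 N0_gt0.
  move=> /le_trans; apply.
  rewrite ler_pdivrMr ?ltr0n // natrD.
  have : 6 * N0%:R * b / eps <= n%:R.
    rewrite (le_trans (nceil_ge _)) // ler_nat (leq_trans (leq_maxr N0 _)) //.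
    by rewrite -/(Neps b eps N0) -/N; lia.
  by rewrite ler_pdivrMr //; lra.
have w_close : `|w - M m m| <= eps / 2.
  apply: (mean_close (u := fun j => M N0 (k + N0 + j))) => // j jn.
  have -> : (k + N0 + j = N0 + (k + j))%N by lia.
  (* The shift [k + j] is at most [h N + (N + g N)], which is [h' N0]. *)
  by rewrite distrC ltW // close // /h' /g' -/N; lia.
by have := ler_distD w (M m m) (M n k); rewrite [`|M m m - w|]distrC; lra.
Qed.

End CesaroConvergence.

Theorem theorem4p12 (R : realType) (X : completeNormedModType R)
    (C : set X) (b : R) (T : X -> X) (eta : R -> R) (c q : R)
    (x : X) (A : rate R)
    (X_uc : uniformly_convex X)
    (C_nonempty : C !=set0) (C_closed : closed C) (C_convex : convex_set C)
    (b_gt0 : 0 < b) (C_bounded : forall y, C y -> `|y| <= b / 2)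
    (T_maps : forall y, C y -> C (T y))
    (T_nonexp : nonexpansive_on C T)
    (T_fix : exists2 p, C p & T p = p)
    (eta_mod : convexity_modulus X eta)
    (c_gt0 : 0 < c) (q_gt1 : 1 < q) (cq_type : type_inequality X c q)
    (Cx : C x) (A_rate : is_alpha_rate T x A) :
  forall (eps : R) (g h : nat -> nat), 0 < eps ->
    exists N : nat,
      [/\ (0 < N)%N,
          (N <= ratePhi b eta (rateB b c q eta A) eps g h)%N &
          forall m n k : nat,
            (N <= m <= N + g N)%N -> (N <= n <= N + g N)%N -> (k <= h N)%N ->
            `|ergodic_mean T m (iter m T x) - ergodic_mean T n (iter k T x)|
              < eps].
Proof.
move=> eps g h eps_gt0; have [p Cp Tp] := T_fix.
have B_rate := rateB_commutation C_convex b_gt0 C_bounded T_maps T_nonexp Cx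
  eta_mod c_gt0 q_gt1 cq_type A_rate.
exact: (ratePhi_spec C_convex b_gt0 C_bounded T_maps T_nonexp Cx B_rate Cp Tp
  eta_mod g h eps_gt0).
Qed.
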